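(* The problem $$(g g')^{(4)}=(z^5 g')^{(4)}\quad\text{in } \mathbb{R},\qquad g(-\infty)=1,\quad g(+\infty)=-1,$$ admits a solution $g(z)$ satisfying the anti-symmetry conditions $g(0)=g''(0)=g^{(4)}(0)=0$ that is positive for $z<0$, monotone decreasing, and real analytic.
   Context: Here $g=g(z)$ is a real-valued function of $z\in\mathbb{R}$, primes and superscripts $(k)$ denote derivatives in $z$, and $g(\pm\infty)$ denotes $\lim_{z\to\pm\infty}g(z)$. Expanded, $(z^5g')^{(4)}=120\,g'z+240\,g''z^2+120\,g'''z^3+20\,g^{(4)}z^4+g^{(5)}z^5$. The ODE arises from substituting $u(x,t)=g(z)$, $z=x/(-t)$, $t<0$, in the PDE $u_{ttttt}=(u\,u_x)_{xxxx}$. *)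

(* Defs.v *)
From Stdlib Require Import Reals.
From Coquelicot Require Import Coquelicot.
Open Scope R_scope.

(* [is_pseries] asserts that the series converges and that its sum is [f x];
   the coefficients and the radius may depend on the centre. *)
Definition real_analytic (f : R -> R) : Prop :=
  forall x0 : R, exists (a : nat -> R) (r : R),
    0 < r /\ forall x : R, Rabs (x - x0) < r -> is_pseries a (x - x0) (f x).

(* [Derive] is total and [ex_derive_n f k] only concerns the last of the k
   differentiations, so differentiability is required at every order up to 5,
   the order of the equation. *)
Definition solves_profile_ode (g : R -> R) : Prop :=
  (forall (k : nat) (z : R), (k <= 5)%nat -> ex_derive_n g k z) /\
  (forall z : R,
    Derive_n (fun y => g y * Derive g y) 4 z =
    Derive_n (fun y => y ^ 5 * Derive g y) 4 z).

(* Main.v *)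
Require Import Defs.
From Stdlib Require Import Reals.
From Coquelicot Require Import Coquelicot.
From Stdlib Require Import Psatz IndefiniteDescription Classical_Pred_Type.
Open Scope R_scope.

(* Integrating four times, an odd [g = - h] solves the equation as soon as
   [(h + z^5) h' = z], and [g(z) -> a^(-5) g(a z)] normalises the limit.  The
   slope [v = h'] satisfies the polynomial equation
   [z v' = v - v^3 - 5 z^4 v^2], and [h = z / v - z^5].  Power series majorants
   solve it near every [p > 0], with a radius controlled by bounds on [p] and
   [v(p)], and also at the singular point [0] along the branch [v(0) = 1].
   There is at most one [h] with [h(0) = 0] and positive slope, because
   [v = z / (h + z^5)] decreases in [h]; hence [h] is odd.  Since
   [0 < h <= z], the local radii are bounded below on compact sets, so [h]
   extends to the whole line, and by uniqueness it is given by the local series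
   near each point.  Finally [h' <= z^(-4)] makes [h] bounded at infinity. *)

(** * Majorants for power series *)

Definition agree (n : nat) (a b : nat -> R) : Prop :=
  forall k : nat, (k <= n)%nat -> a k = b k.

(** Since [F] takes a whole sequence, the recursion is not structural. The approximants [s N] apply
    [F] to complete sequences and are final at all indices up to [N]; the solution is their
    diagonal. *)
Lemma causal_recursion (F : (nat -> R) -> nat -> R) (a0 : R) :
  (forall n a b, agree n a b -> F a n = F b n) ->
  exists a : nat -> R, a 0%nat = a0 /\ forall n, a (S n) = F a n.
Proof.
intros HF.
set (s := fix s N := match N with
  | 0%nat => fun _ : nat => a0
  | S N' => fun n => match n with 0%nat => a0 | S m => F (s N') m end end).
assert (stable : forall N n, (n <= N)%nat -> s (S N) n = s N n).
{ induction N as [|N IH]; intros [|n] Hn; try reflexivity; [lia|].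
  change (F (s (S N)) n = F (s N) n); apply HF; intros k Hk.
  apply IH; lia. }
assert (diag : forall N n, (n <= N)%nat -> s N n = s n n).
{ induction N as [|N IH]; intros n Hn.
  - now replace n with 0%nat by lia.
  - destruct (Nat.eq_dec n (S N)) as [->|Hne]; [reflexivity|].
    rewrite stable by lia; apply IH; lia. }
exists (fun n => s n n); split; [reflexivity|].
intros n; change (F (s n) n = F (fun k => s k k) n).
apply HF; intros k Hk; now apply diag.
Qed.

Lemma agree_mult (n : nat) (a b c d : nat -> R) :
  agree n a b -> agree n c d -> agree n (PS_mult a c) (PS_mult b d).
Proof.
intros Hab Hcd k Hk; unfold PS_mult; apply sum_eq; intros i Hi.
rewrite Hab, Hcd by lia; reflexivity.
Qed.

Lemma agree_plus (n : nat) (a b c d : nat -> R) :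
  agree n a b -> agree n c d -> agree n (PS_plus a c) (PS_plus b d).
Proof.
intros Hab Hcd k Hk; unfold PS_plus; rewrite Hab, Hcd by lia; reflexivity.
Qed.

Lemma agree_scal (n : nat) (c : R) (a b : nat -> R) :
  agree n a b -> agree n (PS_scal c a) (PS_scal c b).
Proof. intros Hab k Hk; unfold PS_scal; rewrite Hab by lia; reflexivity. Qed.

Lemma agree_incr (n : nat) (a b : nat -> R) :
  agree n a b -> agree n (PS_incr_1 a) (PS_incr_1 b).
Proof.
intros Hab [|k] Hk; simpl; [reflexivity|]; apply Hab; lia.
Qed.

(** Partial sums of the weighted l1 norm of the coefficients. This norm is submultiplicative for the
    Cauchy product, so a polynomial in a series is bounded by the same polynomial, with absolute
    coefficients, in its norm. *)
Definition abs_sum (a : nat -> R) (r : R) (N : nat) : R :=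
  sum_f_R0 (fun n => Rabs (a n) * r ^ n) N.

Lemma abs_sum_ge0 (a : nat -> R) (r : R) (N : nat) :
  0 <= r -> 0 <= abs_sum a r N.
Proof.
intros Hr; apply cond_pos_sum; intros n.
apply Rmult_le_pos; [apply Rabs_pos | now apply pow_le].
Qed.

Lemma abs_sum_S (a : nat -> R) (r : R) (N : nat) :
  abs_sum a r (S N) = Rabs (a 0%nat) + r * abs_sum (fun n => a (S n)) r N.
Proof.
unfold abs_sum; rewrite decomp_sum by lia; simpl pred.
rewrite scal_sum, pow_O, Rmult_1_r; f_equal.
apply sum_eq; intros; simpl; ring.
Qed.

Lemma abs_sum_le_mono (a : nat -> R) (r : R) (N : nat) :
  0 <= r -> abs_sum a r N <= abs_sum a r (S N).
Proof.
intros Hr; unfold abs_sum; rewrite tech5.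
assert (0 <= Rabs (a (S N)) * r ^ S N); [|lra].
apply Rmult_le_pos; [apply Rabs_pos | now apply pow_le].
Qed.

Lemma abs_sum_le (a b : nat -> R) (r : R) (N : nat) :
  0 <= r -> (forall n, Rabs (a n) <= b n) -> abs_sum a r N <= abs_sum b r N.
Proof.
intros Hr H; apply sum_Rle; intros n _.
apply Rmult_le_compat_r; [now apply pow_le|].
eapply Rle_trans; [apply H | apply Rle_abs].
Qed.

Lemma abs_sum_plus (a b : nat -> R) (r : R) (N : nat) :
  0 <= r ->
  abs_sum (PS_plus a b) r N <= abs_sum a r N + abs_sum b r N.
Proof.
intros Hr; unfold abs_sum; rewrite <- sum_plus.
apply sum_Rle; intros n _; rewrite <- Rmult_plus_distr_r.
apply Rmult_le_compat_r; [now apply pow_le | apply Rabs_triang].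
Qed.

Lemma abs_sum_scal (c : R) (a : nat -> R) (r : R) (N : nat) :
  abs_sum (PS_scal c a) r N = Rabs c * abs_sum a r N.
Proof.
unfold abs_sum; rewrite scal_sum; apply sum_eq; intros n _.
unfold PS_scal; change (scal c (a n)) with (c * a n); rewrite Rabs_mult; ring.
Qed.

Lemma abs_sum_incr (a : nat -> R) (r : R) (N : nat) :
  0 <= r -> abs_sum (PS_incr_1 a) r N <= r * abs_sum a r N.
Proof.
intros Hr; destruct N as [|N].
- unfold abs_sum; simpl; unfold zero; simpl; rewrite Rabs_R0.
  generalize (Rabs_pos (a 0%nat)); nra.
- rewrite abs_sum_S; simpl PS_incr_1; unfold zero; simpl.
  rewrite Rabs_R0, Rplus_0_l; apply Rmult_le_compat_l; [easy|].
  now apply abs_sum_le_mono.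
Qed.

Lemma sum_convolution (A B : nat -> R) (N : nat) :
  sum_f_R0 (fun n => sum_f_R0 (fun k => A k * B (n - k)%nat) n) N =
  sum_f_R0 (fun k => A k * sum_f_R0 B (N - k)) N.
Proof.
induction N as [|N IH]; [reflexivity|].
rewrite tech5, IH, (tech5 (fun k => A k * B (S N - k)%nat)), tech5.
rewrite <- Rplus_assoc, <- sum_plus; f_equal.
- apply sum_eq; intros k Hk.
  replace (S N - k)%nat with (S (N - k)) by lia; rewrite tech5; ring.
- now rewrite Nat.sub_diag.
Qed.

(** The product sums over the triangle of index pairs with total at most [N], which lies in the
    square where both indices are at most [N]. *)
Lemma abs_sum_mult (a b : nat -> R) (r : R) (N : nat) :
  0 <= r ->
  abs_sum (PS_mult a b) r N <= abs_sum a r N * abs_sum b r N.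
Proof.
intros Hr.
apply Rle_trans with (sum_f_R0 (fun n => sum_f_R0 (fun k =>
  (Rabs (a k) * r ^ k) * (Rabs (b (n - k)%nat) * r ^ (n - k))) n) N).
- apply sum_Rle; intros n _; unfold PS_mult.
  rewrite Rmult_comm.
  apply Rle_trans with
    (r ^ n * sum_f_R0 (fun k => Rabs (a k * b (n - k)%nat)) n).
  + apply Rmult_le_compat_l; [now apply pow_le | apply Rsum_abs].
  + rewrite scal_sum; right; apply sum_eq; intros k Hk.
    replace (r ^ n) with (r ^ k * r ^ (n - k))
      by (rewrite <- pow_add; f_equal; lia).
    rewrite Rabs_mult; ring.
- rewrite (sum_convolution (fun k => Rabs (a k) * r ^ k)
             (fun k => Rabs (b k) * r ^ k)).
  unfold abs_sum at 1; rewrite Rmult_comm, scal_sum.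
  apply sum_Rle; intros k Hk.
  apply Rmult_le_compat_l;
    [apply Rmult_le_pos; [apply Rabs_pos | now apply pow_le]|].
  assert (mono : forall m d, abs_sum b r m <= abs_sum b r (d + m)).
  { intros m d; induction d as [|d IHd]; [simpl; lra|].
    eapply Rle_trans; [apply IHd | now apply abs_sum_le_mono]. }
  replace N with (k + (N - k))%nat at 2 by lia; apply mono.
Qed.

Lemma abs_sum_CV_radius (a : nat -> R) (r M : R) :
  0 <= r -> (forall N, abs_sum a r N <= M) -> Rbar_le r (CV_radius a).
Proof.
intros Hr H; apply (CV_radius_bounded a); exists M; intros n.
eapply Rle_trans; [|apply (H n)].
rewrite Rabs_mult, <- RPow_abs, (Rabs_pos_eq r) by easy.
destruct n as [|n]; unfold abs_sum; [simpl; lra|].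
rewrite tech5; generalize (abs_sum_ge0 a r n Hr); unfold abs_sum; lra.
Qed.

(** * Functions represented by power series with bounded absolute sums *)

(** Bounded absolute sums at [r], rather than a bare radius of convergence: the bound is what the
    majorant recursion delivers, it survives sums and products, and it forces the radius to be at
    least [r]. *)
Definition represents (r : R) (a : nat -> R) (f : R -> R) : Prop :=
  (exists M, forall N, abs_sum a r N <= M) /\
  (forall x, Rabs x < r -> PSeries a x = f x).

Lemma represents_radius (r : R) (a : nat -> R) (f : R -> R) (x : R) :
  represents r a f -> Rabs x < r -> Rbar_lt (Rabs x) (CV_radius a).
Proof.
intros [[M HM] _] Hx.
apply Rbar_lt_le_trans with r; [easy|].
apply abs_sum_CV_radius with M; [|easy].
generalize (Rabs_pos x); lra.
Qed.

Lemma represents_plus (r : R) (a b : nat -> R) (f g : R -> R) :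
  0 <= r -> represents r a f -> represents r b g ->
  represents r (PS_plus a b) (fun x => f x + g x).
Proof.
intros Hr Ha Hb; split.
- destruct Ha as [[M HM] _], Hb as [[M' HM'] _].
  exists (M + M'); intros N.
  generalize (abs_sum_plus a b r N Hr) (HM N) (HM' N); lra.
- intros x Hx; rewrite PSeries_plus.
  + now rewrite (proj2 Ha x Hx), (proj2 Hb x Hx).
  + now apply CV_radius_inside, (represents_radius r a f).
  + now apply CV_radius_inside, (represents_radius r b g).
Qed.

Lemma represents_scal (r c : R) (a : nat -> R) (f : R -> R) :
  represents r a f -> represents r (PS_scal c a) (fun x => c * f x).
Proof.
intros [[M HM] Ha]; split.
- exists (Rabs c * M); intros N; rewrite abs_sum_scal.
  apply Rmult_le_compat_l; [apply Rabs_pos | apply HM].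
- intros x Hx; rewrite PSeries_scal, Ha by easy; reflexivity.
Qed.

Lemma represents_mult (r : R) (a b : nat -> R) (f g : R -> R) :
  0 <= r -> represents r a f -> represents r b g ->
  represents r (PS_mult a b) (fun x => f x * g x).
Proof.
intros Hr Ha Hb; split.
- destruct Ha as [[M HM] _], Hb as [[M' HM'] _].
  exists (M * M'); intros N.
  eapply Rle_trans; [now apply abs_sum_mult|].
  apply Rmult_le_compat; auto using abs_sum_ge0.
- intros x Hx; rewrite PSeries_mult.
  + now rewrite (proj2 Ha x Hx), (proj2 Hb x Hx).
  + now apply (represents_radius r a f).
  + now apply (represents_radius r b g).
Qed.

Lemma represents_incr (r : R) (a : nat -> R) (f : R -> R) :
  0 <= r -> represents r a f -> represents r (PS_incr_1 a) (fun x => x * f x).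
Proof.
intros Hr [[M HM] Ha]; split.
- exists (r * M); intros N.
  eapply Rle_trans; [now apply abs_sum_incr|].
  now apply Rmult_le_compat_l.
- intros x Hx; rewrite PSeries_incr_1, Ha by easy; reflexivity.
Qed.

(* Partial sums of the majorant obey S_{N+1} <= |a_0| + r B(S_N), so a radius
   with r B(|a_0| + eta) <= eta confines all of them. *)
Lemma majorant_recursion (F : (nat -> R) -> nat -> R) (B : R -> R)
    (a0 r eta : R) :
  (forall n a b, agree n a b -> F a n = F b n) ->
  (forall a N, abs_sum (F a) r N <= B (abs_sum a r N)) ->
  (forall S T, 0 <= S <= T -> B S <= B T) ->
  0 <= r -> 0 <= eta -> r * B (Rabs a0 + eta) <= eta ->
  exists a : nat -> R, a 0%nat = a0 /\ (forall n, a (S n) = F a n) /\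
    (forall N, abs_sum a r N <= Rabs a0 + eta).
Proof.
intros HF HB Hmono Hr Heta Hsmall.
destruct (causal_recursion F a0 HF) as [a [Ha0 HaS]].
exists a; split; [easy|]; split; [easy|].
induction N as [|N IH].
- unfold abs_sum; simpl; rewrite Ha0; lra.
- rewrite abs_sum_S, Ha0.
  assert (r * abs_sum (fun n => a (S n)) r N <= eta); [|lra].
  eapply Rle_trans; [|exact Hsmall].
  apply Rmult_le_compat_l; [easy|].
  apply Rle_trans with (abs_sum (F a) r N).
  + right; unfold abs_sum; apply sum_eq; intros; now rewrite HaS.
  + eapply Rle_trans; [apply HB|].
    apply Hmono; split; [now apply abs_sum_ge0 | easy].
Qed.

(** The terms of positive order have absolute sum at most [eta]. This keeps the sum of a local
    series positive when [eta] is small against its value at the centre. *)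
Lemma PSeries_near_center (a : nat -> R) (r eta x : R) :
  (forall N, abs_sum a r N <= Rabs (a 0%nat) + eta) -> Rabs x < r ->
  Rabs (PSeries a x - a 0%nat) <= eta.
Proof.
intros H Hx.
assert (Hr : 0 <= r) by (generalize (Rabs_pos x); lra).
assert (Hcv : is_pseries a x (PSeries a x)).
{ apply PSeries_correct, CV_radius_inside, Rbar_lt_le_trans with r; [easy|].
  now apply abs_sum_CV_radius with (Rabs (a 0%nat) + eta). }
apply is_pseries_R in Hcv.
assert (Hb : forall N, Rabs (sum_n (fun n => a n * x ^ n) N - a 0%nat) <= eta).
{ intros N; rewrite sum_n_Reals; destruct N as [|N].
  - simpl; rewrite Rmult_1_r, Rminus_diag, Rabs_R0.
    generalize (H 0%nat); unfold abs_sum; simpl; lra.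
  - rewrite decomp_sum by lia; simpl pred.
    replace (_ - a 0%nat)
      with (sum_f_R0 (fun i => a (S i) * x ^ S i) N) by (simpl; ring).
    eapply Rle_trans; [apply Rsum_abs|].
    apply Rle_trans with (r * abs_sum (fun n => a (S n)) r N).
    + unfold abs_sum; rewrite scal_sum; apply sum_Rle; intros n _.
      rewrite Rabs_mult, <- RPow_abs.
      replace (Rabs (a (S n)) * r ^ n * r) with (Rabs (a (S n)) * r ^ S n)
        by (simpl; ring).
      apply Rmult_le_compat_l; [apply Rabs_pos|].
      apply pow_incr; split; [apply Rabs_pos | lra].
    + generalize (H (S N)); rewrite abs_sum_S; lra. }
assert (Hlim : is_lim_seq
  (fun N => Rabs (sum_n (fun n => a n * x ^ n) N - a 0%nat))
  (Rabs (PSeries a x - a 0%nat))).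
{ apply (is_lim_seq_abs _ (Finite (PSeries a x - a 0%nat))).
  apply is_lim_seq_minus'; [exact Hcv | apply is_lim_seq_const]. }
exact (is_lim_seq_le _ _ _ _ Hb Hlim (is_lim_seq_const eta)).
Qed.

(** * Local series for the slope *)

Lemma represents_ext (r : R) (a : nat -> R) (f g : R -> R) :
  (forall x, f x = g x) -> represents r a f -> represents r a g.
Proof.
intros Hfg [H1 H2]; split; [easy|]; intros x Hx; rewrite H2 by easy; auto.
Qed.

(** Multiplication by [z = p + x] in powers of the local variable [x = z - p]. *)
Definition PS_shift (p : R) (a : nat -> R) : nat -> R :=
  PS_plus (PS_scal p a) (PS_incr_1 a).

Lemma abs_sum_shift (p r K : R) (a : nat -> R) (N : nat) :
  0 <= r -> Rabs p + r <= K -> abs_sum (PS_shift p a) r N <= K * abs_sum a r N.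
Proof.
intros Hr HK; eapply Rle_trans; [now apply abs_sum_plus|].
rewrite abs_sum_scal.
generalize (abs_sum_incr a r N Hr) (abs_sum_ge0 a r N Hr); nra.
Qed.

Lemma represents_shift (p r : R) (a : nat -> R) (f : R -> R) :
  0 <= r -> represents r a f ->
  represents r (PS_shift p a) (fun x => (p + x) * f x).
Proof.
intros Hr H; apply represents_ext with (fun x => p * f x + x * f x).
- intros; ring.
- apply represents_plus; [easy | now apply represents_scal|].
  now apply represents_incr.
Qed.

(* Taylor coefficients at [p] of [v - v^3 - 5 z^4 v^2]. *)
Definition slope_rhs (p : R) (a : nat -> R) : nat -> R :=
  PS_plus a (PS_plus (PS_scal (-1) (PS_mult a (PS_mult a a)))
    (PS_scal (-5)
      (PS_shift p (PS_shift p (PS_shift p (PS_shift p (PS_mult a a))))))).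

Lemma agree_slope_rhs (p : R) (n : nat) (a b : nat -> R) :
  agree n a b -> agree n (slope_rhs p a) (slope_rhs p b).
Proof.
intros H; unfold slope_rhs, PS_shift.
repeat first [exact H | apply agree_plus | apply agree_scal | apply agree_mult
  | apply agree_incr].
Qed.

Lemma represents_slope_rhs (p r : R) (a : nat -> R) (f : R -> R) :
  0 <= r -> represents r a f ->
  represents r (slope_rhs p a)
    (fun x => f x - f x ^ 3 - 5 * (p + x) ^ 4 * f x ^ 2).
Proof.
intros Hr H.
eapply represents_ext;
  [|repeat first [exact H | apply represents_shift | apply represents_plus
    | apply represents_scal | apply represents_mult]; easy].
intros x; simpl; ring.
Qed.

Lemma abs_sum_slope_rhs (p r K : R) (a : nat -> R) (N : nat) :
  0 <= r -> 0 <= K -> Rabs p + r <= K ->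
  abs_sum (slope_rhs p a) r N <=
  abs_sum a r N + abs_sum a r N ^ 3 + 5 * K ^ 4 * abs_sum a r N ^ 2.
Proof.
intros Hr HK HpK.
assert (H2 := abs_sum_mult a a r N Hr).
assert (H3 := abs_sum_mult a (PS_mult a a) r N Hr).
assert (S0 := abs_sum_ge0 a r N Hr).
assert (Hsh : forall b c, abs_sum b r N <= c ->
          abs_sum (PS_shift p b) r N <= K * c).
{ intros b c Hb; eapply Rle_trans; [now apply abs_sum_shift with (K := K)|].
  now apply Rmult_le_compat_l. }
assert (H4 := Hsh _ _ (Hsh _ _ (Hsh _ _ (Hsh _ _ H2)))).
eapply Rle_trans; [now apply abs_sum_plus|].
eapply Rle_trans; [apply Rplus_le_compat_l; now apply abs_sum_plus|].
rewrite !abs_sum_scal.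
replace (Rabs (-1)) with 1 by (rewrite Rabs_left; lra).
replace (Rabs (-5)) with 5 by (rewrite Rabs_left; lra).
assert (abs_sum (PS_mult a (PS_mult a a)) r N <= abs_sum a r N ^ 3).
{ eapply Rle_trans; [exact H3|].
  replace (abs_sum a r N ^ 3) with (abs_sum a r N * (abs_sum a r N * abs_sum a r N))
    by ring.
  now apply Rmult_le_compat_l. }
nra.
Qed.

(** The slope equation at [z = p + x]. Positivity is recorded because the height is recovered as
    [z / v - z^5]. *)
Definition local_slope (p r : R) (a : nat -> R) : Prop :=
  forall x, Rabs x < r ->
    Rbar_lt (Rabs x) (CV_radius a) /\ 0 < PSeries a x /\
    (p + x) * PSeries (PS_derive a) x =
    PSeries a x - PSeries a x ^ 3 - 5 * (p + x) ^ 4 * PSeries a x ^ 2.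

Lemma PSeries_shift_derive (p : R) (a : nat -> R) (x : R) :
  Rbar_lt (Rabs x) (CV_radius a) ->
  PSeries (PS_shift p (PS_derive a)) x = (p + x) * PSeries (PS_derive a) x.
Proof.
intros Hx; apply ex_pseries_derive in Hx.
unfold PS_shift; rewrite PSeries_plus, PSeries_scal, PSeries_incr_1.
- ring.
- now apply @ex_pseries_scal; [apply Rmult_comm|].
- now apply ex_pseries_incr_1.
Qed.

(** The radius is chosen before [p] and [v0]. This uniformity on compact sets is what makes
    continuation by a fixed step possible. *)
Lemma local_slope_regular (z0 Z m M : R) :
  0 < z0 -> 0 < m <= M ->
  exists r, 0 < r /\ forall p v0, z0 <= p <= Z -> m <= v0 <= M ->
    exists a, a 0%nat = v0 /\ local_slope p r a.
Proof.
intros Hz0 [Hm HmM].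
(* The factor [/ z0] bounds [/ p]. One [S] in [2 * S] comes from the linear term of [slope_rhs], the
   other from [INR n * a n]; [Z + 1] bounds [Rabs p + r]. *)
set (B := fun S => / z0 * (2 * S + S ^ 3 + 5 * (Z + 1) ^ 4 * S ^ 2)).
(* A deviation of at most [m / 2] from [v0 >= m] leaves the slope positive. *)
assert (Heta : exists eta, 0 < eta <= m / 2) by (exists (m / 2); lra).
destruct Heta as [eta Heta].
destruct (Rlt_dec Z z0) as [HZ|HZ].
{ exists 1; split; [lra|]; intros; exfalso; lra. }
assert (Hz0' : 0 < / z0) by now apply Rinv_0_lt_compat.
assert (K4 : 0 <= 5 * (Z + 1) ^ 4)
  by (apply Rmult_le_pos; [lra | apply pow_le; lra]).
assert (Bmono : forall S T, 0 <= S <= T -> B S <= B T).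
{ intros S T HST; unfold B; apply Rmult_le_compat_l; [lra|].
  assert (S ^ 3 <= T ^ 3) by now apply pow_incr.
  assert (S ^ 2 <= T ^ 2) by now apply pow_incr.
  nra. }
assert (BM : 0 <= B (M + eta)).
{ replace 0 with (B 0) by (unfold B; simpl; ring).
  apply Bmono; lra. }
(* The bound [1] gives [Rabs p + r <= Z + 1]; the other gives [r * B (M + eta) <= eta], with [1 +]
   keeping the denominator positive. *)
set (r := Rmin 1 (eta / (1 + B (M + eta)))).
assert (Hr : 0 < r).
{ apply Rmin_glb_lt; [lra|]; apply Rdiv_lt_0_compat; lra. }
exists r; split; [easy|]; intros p v0 Hp Hv0.
(* The coefficient of [x^n] in [(p + x) v'] is [p (n + 1) a_(n+1) + n a_n]; [F] solves for
   [a_(n+1)]. *)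
set (F := fun a n => (slope_rhs p a n - INR n * a n) / (p * INR (S n))).
destruct (majorant_recursion F B v0 r eta) as [a [Ha0 [HaS Hb]]].
- intros n a b Hab; unfold F.
  rewrite (agree_slope_rhs p n a b Hab n), (Hab n) by lia; reflexivity.
- intros a N.
  apply Rle_trans with (abs_sum (fun n =>
    / z0 * (Rabs (slope_rhs p a n) + Rabs (a n))) r N).
  + apply abs_sum_le; [lra|]; intros n; unfold F.
    assert (Hn : 0 <= INR n) by apply pos_INR.
    rewrite S_INR; unfold Rdiv; rewrite Rabs_mult, Rabs_inv.
    rewrite (Rabs_pos_eq (p * _)) by nra.
    apply Rmult_le_reg_r with (p * (INR n + 1)); [nra|].
    rewrite Rmult_assoc, Rinv_l, Rmult_1_r by nra.
    eapply Rle_trans; [apply Rabs_triang|].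
    rewrite Rabs_Ropp, Rabs_mult, (Rabs_pos_eq (INR n)) by easy.
    assert (1 <= / z0 * p)
      by (apply Rmult_le_reg_l with z0; [easy|]; field_simplify; lra).
    assert (Hq1 := Rabs_pos (slope_rhs p a n)); assert (Hq2 := Rabs_pos (a n)).
    replace (/ z0 * (Rabs (slope_rhs p a n) + Rabs (a n)) * (p * (INR n + 1)))
      with ((/ z0 * p) * ((INR n + 1) * (Rabs (slope_rhs p a n) + Rabs (a n))))
      by ring.
    apply Rle_trans with (1 * ((INR n + 1) * (Rabs (slope_rhs p a n) + Rabs (a n)))).
    * nra.
    * apply Rmult_le_compat_r; [nra | easy].
  + apply Rle_trans with (/ z0 * (abs_sum (slope_rhs p a) r N + abs_sum a r N)).
    * unfold abs_sum; rewrite <- sum_plus, scal_sum; right.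
      apply sum_eq; intros n _; rewrite Rabs_pos_eq; [ring|].
      apply Rmult_le_pos; [lra|].
      generalize (Rabs_pos (slope_rhs p a n)) (Rabs_pos (a n)); lra.
    * unfold B; apply Rmult_le_compat_l; [lra|].
      assert (Hs := abs_sum_slope_rhs p r (Z + 1) a N).
      assert (Rabs p + r <= Z + 1).
      { rewrite Rabs_pos_eq by lra; generalize (Rmin_l 1 (eta / (1 + B (M + eta)))).
        fold r; lra. }
      lra.
- exact Bmono.
- lra.
- lra.
- rewrite Rabs_pos_eq by lra.
  apply Rle_trans with (r * (1 + B (M + eta))).
  + apply Rmult_le_compat_l; [lra|].
    assert (B (v0 + eta) <= B (M + eta)); [|lra].
    apply Bmono; lra.
  + apply Rmult_le_reg_r with (/ (1 + B (M + eta)));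
      [apply Rinv_0_lt_compat; lra|].
    rewrite Rmult_assoc, Rinv_r, Rmult_1_r by lra; apply Rmin_r.
- exists a; split; [easy|]; intros x Hx.
  assert (Hrep : represents r a (PSeries a)) by (split; [eexists; exact Hb|easy]).
  assert (Hrad := represents_radius r a _ x Hrep Hx).
  split; [easy|]; split.
  + rewrite <- Ha0 in Hb.
    generalize (PSeries_near_center a r eta x Hb Hx); rewrite Ha0.
    intros H; apply Rabs_le_between in H; lra.
  + rewrite <- PSeries_shift_derive by easy.
    rewrite <- (proj2 (represents_slope_rhs p r a _ (Rlt_le _ _ Hr) Hrep) x Hx).
    apply PSeries_ext; intros n.
    assert (Hn : 0 <= INR n) by apply pos_INR.
    assert (Hd : INR (S n) <> 0) by (rewrite S_INR; lra).
    transitivity (p * (INR (S n) * a (S n)) + INR n * a n).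
    * unfold PS_shift, PS_plus, PS_scal; change plus with Rplus;
        change scal with Rmult; unfold PS_derive at 1; f_equal.
      destruct n as [|n]; [simpl; unfold zero; simpl; ring | reflexivity].
    * rewrite HaS; unfold F; field; split; [easy|lra].
Qed.

(* At the singular point [0] the branch is [v = 1 + x eta], where
   [x eta' + 3 eta = - x (3 eta^2 + x eta^3 + 5 x^2 (1 + x eta)^2)]. *)
Definition singular_rhs (e : nat -> R) : nat -> R :=
  let u := PS_plus (fun n => if n then 1 else 0) (PS_incr_1 e) in
  PS_plus (PS_scal 3 (PS_mult e e))
    (PS_plus (PS_incr_1 (PS_mult e (PS_mult e e)))
      (PS_scal 5 (PS_incr_1 (PS_incr_1 (PS_mult u u))))).

Lemma represents_one (r : R) :
  0 <= r -> represents r (fun n => if n then 1 else 0) (fun _ => 1).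
Proof.
assert (Hsum : forall c x n, sum_f_R0
  (fun k => (if k then c else 0) * x ^ k) n = c).
{ intros c x n; induction n as [|n IH]; [simpl; ring|].
  rewrite tech5, IH; ring. }
intros Hr; split.
- exists 1; intros N; unfold abs_sum; right.
  apply eq_trans with (2 := Hsum 1 r N); apply sum_eq; intros [|i] _.
  + now rewrite Rabs_R1.
  + now rewrite Rabs_R0.
- intros x _; apply is_pseries_unique, is_pseries_R.
  change (is_lim_seq (sum_n (fun k => (if k then 1 else 0) * x ^ k)) 1).
  apply is_lim_seq_ext with (fun _ => 1); [|apply is_lim_seq_const].
  intros n; now rewrite sum_n_Reals, Hsum.
Qed.

Lemma represents_singular_rhs (r : R) (e : nat -> R) (f : R -> R) :
  0 <= r -> represents r e f ->
  represents r (singular_rhs e)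
    (fun x => 3 * f x ^ 2 + x * f x ^ 3 + 5 * x ^ 2 * (1 + x * f x) ^ 2).
Proof.
intros Hr H; assert (H1 := represents_one r Hr).
eapply represents_ext;
  [|unfold singular_rhs; repeat first [exact H | exact H1
    | apply represents_plus | apply represents_scal | apply represents_mult
    | apply represents_incr]; easy].
intros x; simpl; ring.
Qed.

Lemma agree_singular_rhs (n : nat) (a b : nat -> R) :
  agree n a b -> agree n (singular_rhs a) (singular_rhs b).
Proof.
intros H; unfold singular_rhs.
repeat first [exact H | apply agree_plus | apply agree_scal | apply agree_mult
  | apply agree_incr | easy].
Qed.

Lemma abs_sum_singular_rhs (r : R) (e : nat -> R) (N : nat) :
  0 <= r <= 1 ->
  abs_sum (singular_rhs e) r N <=
  3 * abs_sum e r N ^ 2 + abs_sum e r N ^ 3 + 5 * (1 + abs_sum e r N) ^ 2.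
Proof.
intros [Hr Hr1].
set (u := PS_plus (fun n => if n then 1 else 0) (PS_incr_1 e)).
assert (Hincr : forall b, abs_sum (PS_incr_1 b) r N <= abs_sum b r N).
{ intros b; generalize (abs_sum_incr b r N Hr) (abs_sum_ge0 b r N Hr); nra. }
assert (S0 := abs_sum_ge0 e r N Hr).
assert (Hu0 := abs_sum_ge0 u r N Hr).
assert (Hu : abs_sum u r N <= 1 + abs_sum e r N).
{ eapply Rle_trans; [now apply abs_sum_plus|].
  apply Rplus_le_compat; [|apply Hincr].
  clear; induction N as [|N IH]; unfold abs_sum in *.
  - simpl; rewrite Rabs_R1; lra.
  - rewrite tech5, Rabs_R0; lra. }
eapply Rle_trans; [now apply abs_sum_plus|].
rewrite abs_sum_scal, Rabs_pos_eq by lra.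
rewrite Rplus_assoc; apply Rplus_le_compat.
- apply Rmult_le_compat_l; [lra|]; simpl; rewrite Rmult_1_r.
  now apply abs_sum_mult.
- eapply Rle_trans; [now apply abs_sum_plus|]; apply Rplus_le_compat.
  + eapply Rle_trans; [apply Hincr|].
    eapply Rle_trans; [now apply abs_sum_mult|].
    change (abs_sum e r N ^ 3) with
      (abs_sum e r N * (abs_sum e r N * (abs_sum e r N * 1))).
    rewrite Rmult_1_r.
    apply Rmult_le_compat_l; [easy | now apply abs_sum_mult].
  + rewrite abs_sum_scal, Rabs_pos_eq by lra; apply Rmult_le_compat_l; [lra|].
    eapply Rle_trans; [apply Hincr|]; eapply Rle_trans; [apply Hincr|].
    eapply Rle_trans; [now apply abs_sum_mult|]; fold u.
    replace (abs_sum u r N * abs_sum u r N) with (abs_sum u r N ^ 2) by ring.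
    now apply pow_incr.
Qed.

(** At order [n + 1] the operator [x eta' + 3 eta] multiplies the coefficient by [n + 4], which
    never vanishes, so the recursion for [eta] runs through the singular point; order [0] forces
    [eta(0) = 0]. *)
Lemma local_slope_singular :
  exists r a, 0 < r /\ a 0%nat = 1 /\ local_slope 0 r a.
Proof.
(* With [eta] bounded by [/ 2] the majorant is [3/4 + 1/8 + 45/4 < 20], so the radius [/ 40]
   satisfies the smallness condition. *)
set (r := / 40); assert (Hr : 0 <= r <= 1) by (unfold r; lra).
destruct (majorant_recursion (fun e n => - singular_rhs e n / (INR n + 4))
  (fun S => 3 * S ^ 2 + S ^ 3 + 5 * (1 + S) ^ 2) 0 r (/ 2))
  as [e [He0 [HeS Hb]]].
- intros n a b Hab; now rewrite (agree_singular_rhs n a b Hab n).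
- intros a N; eapply Rle_trans; [|now apply abs_sum_singular_rhs].
  apply sum_Rle; intros n _; apply Rmult_le_compat_r; [now apply pow_le|].
  assert (Hn := pos_INR n).
  unfold Rdiv; rewrite Rabs_mult, Rabs_Ropp, Rabs_inv.
  rewrite (Rabs_pos_eq (INR n + 4)) by lra.
  rewrite <- (Rmult_1_r (Rabs (singular_rhs a n))) at 2.
  apply Rmult_le_compat_l; [apply Rabs_pos|].
  rewrite <- Rinv_1; apply Rinv_le_contravar; lra.
- intros S T H; assert (S ^ 2 <= T ^ 2) by now apply pow_incr.
  assert (S ^ 3 <= T ^ 3) by now apply pow_incr.
  nra.
- easy.
- lra.
- rewrite Rabs_R0; unfold r; lra.
- set (a := PS_plus (fun n => if n then 1 else 0) (PS_incr_1 e) : nat -> R).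
  exists r, a.
  split; [unfold r; lra|]; split.
  { unfold a, PS_plus; simpl; unfold zero; simpl; change plus with Rplus; ring. }
  assert (Hrep : represents r e (PSeries e)) by (split; [eexists; exact Hb|easy]).
  assert (Hrep' : represents r a (fun x => 1 + x * PSeries e x)).
  { apply represents_plus; [easy | now apply represents_one |].
    now apply represents_incr. }
  intros x Hx.
  rewrite (proj2 Hrep' x Hx), Rplus_0_l.
  split; [now apply (represents_radius r _ _ x Hrep')|].
  assert (Hrad := represents_radius r e _ x Hrep Hx).
  assert (Hcv := ex_pseries_derive e x Hrad).
  rewrite <- He0 in Hb.
  assert (Hsmall : Rabs (PSeries e x) <= / 2).
  { generalize (PSeries_near_center e r (/ 2) x); rewrite He0, Rminus_0_r.
    rewrite He0 in Hb; auto. }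
  split.
  { assert (Rabs (x * PSeries e x) <= 1 * / 2).
    { rewrite Rabs_mult; apply Rmult_le_compat; auto using Rabs_pos; lra. }
    apply Rabs_le_between in H; lra. }
  assert (Hode : x * PSeries (PS_derive e) x + 3 * PSeries e x =
    - (x * (3 * PSeries e x ^ 2 + x * PSeries e x ^ 3
       + 5 * x ^ 2 * (1 + x * PSeries e x) ^ 2))).
  { rewrite <- (proj2 (represents_singular_rhs r e _ (proj1 Hr) Hrep) x Hx).
    rewrite <- !PSeries_incr_1, <- PSeries_scal, <- PSeries_plus, <- PSeries_opp.
    - apply PSeries_ext; intros [|n]; unfold PS_plus, PS_scal, PS_opp;
        change plus with Rplus; change scal with Rmult; change opp with Ropp;
        simpl PS_incr_1.
      + rewrite He0; unfold zero; simpl; ring.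
      + assert (Hn := pos_INR n).
        unfold PS_derive; rewrite HeS, S_INR; field; lra.
    - now apply ex_pseries_incr_1.
    - apply @ex_pseries_scal; [apply Rmult_comm|].
      now apply CV_radius_inside. }
  replace (PSeries (PS_derive a) x)
    with (PSeries e x + x * PSeries (PS_derive e) x).
  + replace (PSeries e x + x * PSeries (PS_derive e) x)
      with ((x * PSeries (PS_derive e) x + 3 * PSeries e x) - 2 * PSeries e x)
      by ring.
    rewrite Hode; ring.
  + rewrite <- PSeries_incr_1, <- PSeries_plus;
      [|now apply CV_radius_inside|now apply ex_pseries_incr_1].
    apply PSeries_ext; intros n; unfold a, PS_plus, PS_derive at 2.
    change plus with Rplus; rewrite S_INR; simpl PS_incr_1.
    destruct n as [|n]; [simpl; unfold zero; simpl; ring|].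
    unfold PS_incr_1, PS_derive; ring.
Qed.

(** * Uniqueness and a priori bounds *)

Lemma nonincreasing_of_derive (f : R -> R) (a b : R) :
  a <= b -> (forall z, a <= z <= b -> exists d, d <= 0 /\ is_derive f z d) ->
  f b <= f a.
Proof.
intros Hab H.
destruct (MVT_gen f a b (Derive f)) as [c [Hc Heq]];
  rewrite ?Rmin_left, ?Rmax_right in * by easy.
- intros x Hx; destruct (H x) as [d [_ Hd]]; [lra|].
  now rewrite (is_derive_unique _ _ _ Hd).
- intros x Hx; destruct (H x) as [d [_ Hd]]; [lra|].
  apply derivable_continuous_pt; exists d; now apply is_derive_Reals.
- destruct (H c Hc) as [d [Hd0 Hd]].
  rewrite (is_derive_unique _ _ _ Hd) in Heq; nra.
Qed.

(* With [g = - h], the first-order equation [g g' - z^5 g' = z]. *)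
Definition slope_at (h : R -> R) (z v : R) : Prop :=
  0 < v /\ is_derive h z v /\ v * (h z + z ^ 5) = z.

Definition solution_on (a b : R) (h : R -> R) : Prop :=
  h 0 = 0 /\ forall z, a < z < b -> exists v, slope_at h z v.

Lemma slope_at_increasing (h : R -> R) (a b : R) :
  a <= b -> (forall z, a <= z <= b -> exists v, slope_at h z v) -> h a <= h b.
Proof.
intros Hab H; apply Ropp_le_cancel.
apply (nonincreasing_of_derive (fun y => - h y)); [easy|].
intros z Hz; destruct (H z Hz) as [v [Hv [Hd _]]].
exists (- v); split; [lra | now apply (is_derive_opp h)].
Qed.

(** Equal end values would make the nondecreasing [h] constant on the interval, against its positive
    slope at [a]. *)
Lemma slope_at_strict_increasing (h : R -> R) (a b : R) :
  a < b -> (forall z, a <= z <= b -> exists v, slope_at h z v) -> h a < h b.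
Proof.
intros Hab H.
destruct (Rle_lt_or_eq_dec (h a) (h b)) as [|Heq]; [|easy|].
{ apply slope_at_increasing; [lra|easy]. }
exfalso.
destruct (H a) as [v [Hv [Hd _]]]; [lra|].
assert (Hconst : forall z, a <= z <= b -> h z = h a).
{ intros z Hz; apply Rle_antisym.
  - rewrite Heq; apply slope_at_increasing; [lra|]; intros; apply H; lra.
  - apply slope_at_increasing; [lra|]; intros; apply H; lra. }
apply is_derive_Reals in Hd.
(* With tolerance [v] itself, a vanishing difference quotient would give [v < v]. *)
destruct (Hd v Hv) as [d Hdel].
set (t := Rmin (d / 2) (b - a)).
assert (Ht : 0 < t <= b - a /\ t < d).
{ assert (Hdp := cond_pos d); unfold t.
  assert (H1 := Rmin_l (d / 2) (b - a)); assert (H2 := Rmin_r (d / 2) (b - a)).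
  split; [split; [apply Rmin_glb_lt; lra | easy] | lra]. }
specialize (Hdel t); rewrite (Hconst (a + t)) in Hdel by lra.
assert (HH : Rabs ((h a - h a) / t - v) < v)
  by (apply Hdel; [lra | rewrite Rabs_pos_eq; lra]).
replace ((h a - h a) / t - v) with (- v) in HH by (field; lra).
rewrite Rabs_Ropp, Rabs_pos_eq in HH; lra.
Qed.

Lemma slope_at_ext_loc (h k : R -> R) (z v : R) :
  locally z (fun y => h y = k y) -> slope_at h z v -> slope_at k z v.
Proof.
intros Hloc [Hv [Hd He]]; split; [easy|]; split.
- now apply (is_derive_ext_loc h).
- now rewrite <- (locally_singleton _ _ Hloc).
Qed.

(** The first-order equation is invariant under [(z, h) -> (-z, -h)] because [z^5] is odd. Results
    on the negative half-line and the oddness of the solution both come from this symmetry. *)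
Lemma slope_at_reflect (h : R -> R) (z v : R) :
  slope_at h (- z) v -> slope_at (fun y => - h (- y)) z v.
Proof.
intros [Hv [Hd He]]; split; [easy|]; split.
- evar_last.
  + apply (is_derive_opp (fun y => h (- y))).
    apply (is_derive_comp h Ropp z v (-1)); [exact Hd|].
    auto_derive; [easy | ring].
  + unfold scal, opp, one; simpl; unfold mult; simpl; ring.
- replace (- h (- z) + z ^ 5) with (- (h (- z) + (- z) ^ 5)) by ring.
  lra.
Qed.

(* [v = z / (h + z^5)] decreases in [h], so the gap of two solutions shrinks. *)
Lemma slope_gap (h1 h2 z v1 v2 : R) :
  0 <= z -> 0 < v1 -> 0 < v2 ->
  v1 * (h1 + z ^ 5) = z -> v2 * (h2 + z ^ 5) = z ->
  (h1 - h2) * (v1 - v2) <= 0.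
Proof.
intros Hz Hv1 Hv2 E1 E2.
assert (E : (v1 - v2) * (h1 + z ^ 5) = - v2 * (h1 - h2)) by lra.
assert (HG : 0 <= h1 + z ^ 5).
{ apply Rmult_le_reg_l with v1; [easy|]; lra. }
destruct (Rle_lt_or_eq_dec 0 (h1 + z ^ 5) HG) as [Hpos|Hzero].
- apply Rmult_le_reg_l with (h1 + z ^ 5); [easy|].
  replace ((h1 + z ^ 5) * ((h1 - h2) * (v1 - v2)))
    with (- v2 * (h1 - h2) * (h1 - h2)) by (rewrite <- E; ring).
  generalize (Rle_0_sqr (h1 - h2)); unfold Rsqr; nra.
- rewrite <- Hzero in E.
  assert (h1 - h2 = 0) by nra.
  rewrite H; lra.
Qed.

(** By [slope_gap] the square of the difference is nonincreasing. No Lipschitz bound enters, so the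
    start [a] may be the singular point [0]. *)
Lemma solution_unique_forward (h1 h2 : R -> R) (a b : R) :
  0 <= a <= b ->
  (forall z, a <= z <= b -> exists v, slope_at h1 z v) ->
  (forall z, a <= z <= b -> exists v, slope_at h2 z v) ->
  h1 a = h2 a -> h1 b = h2 b.
Proof.
intros Hab H1 H2 Ha.
assert (H : (h1 b - h2 b) ^ 2 <= (h1 a - h2 a) ^ 2).
{ apply (nonincreasing_of_derive (fun z => (h1 z - h2 z) ^ 2)); [lra|].
  intros z Hz; destruct (H1 z Hz) as [v1 [V1 [D1 E1]]].
  destruct (H2 z Hz) as [v2 [V2 [D2 E2]]].
  exists (2 * (h1 z - h2 z) * (v1 - v2)); split.
  - assert (Hg := slope_gap (h1 z) (h2 z) z v1 v2); nra.
  - evar_last; [apply is_derive_pow, @is_derive_minus; eassumption|].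
    unfold minus, plus, opp; simpl; ring. }
rewrite Ha, Rminus_diag in H; nra.
Qed.

(* Gronwall: [h1 - h2] decays at a rate at most [C], so its square times
   [exp (2 C z)] is nondecreasing. *)
Lemma solution_unique_backward (h1 h2 : R -> R) (a b : R) :
  0 < a <= b ->
  (forall z, a <= z <= b -> exists v, slope_at h1 z v) ->
  (forall z, a <= z <= b -> exists v, slope_at h2 z v) ->
  0 < h1 a -> 0 < h2 a -> h1 b = h2 b -> h1 a = h2 a.
Proof.
intros Hab H1 H2 P1 P2 Hb.
(* Here [v1 - v2 = - v2 / (h1 + z^5) * (h1 - h2)]. Positive heights give [v2 <= / z^4 <= / a^4] and
   [h1 + z^5 >= a^5]. *)
set (C := / a ^ 4 * / a ^ 5).
assert (A4 : 0 < a ^ 4) by (apply pow_lt; lra).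
assert (A5 : 0 < a ^ 5) by (apply pow_lt; lra).
assert (H : - ((h1 b - h2 b) ^ 2 * exp (2 * C * b))
         <= - ((h1 a - h2 a) ^ 2 * exp (2 * C * a))).
{ apply (nonincreasing_of_derive
    (fun z => - ((h1 z - h2 z) ^ 2 * exp (2 * C * z)))); [lra|].
  intros z Hz; destruct (H1 z Hz) as [v1 [V1 [D1 E1]]].
  destruct (H2 z Hz) as [v2 [V2 [D2 E2]]].
  exists (- (2 * (h1 z - h2 z) * (v1 - v2) + 2 * C * (h1 z - h2 z) ^ 2)
          * exp (2 * C * z)); split.
  - assert (Hexp := exp_pos (2 * C * z)).
    assert (Hz5 : a ^ 5 <= z ^ 5) by (apply pow_incr; lra).
    assert (Hz4 : a ^ 4 <= z ^ 4) by (apply pow_incr; lra).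
    assert (Q1 : 0 < h1 z).
    { apply Rlt_le_trans with (h1 a); [easy|]; apply slope_at_increasing; [lra|].
      intros; apply H1; lra. }
    assert (Q2 : 0 < h2 z).
    { apply Rlt_le_trans with (h2 a); [easy|]; apply slope_at_increasing; [lra|].
      intros; apply H2; lra. }
    assert (G1 : 0 < h1 z + z ^ 5) by lra.
    assert (E : v1 - v2 = - (v2 * / (h1 z + z ^ 5)) * (h1 z - h2 z)).
    { apply Rmult_eq_reg_r with (h1 z + z ^ 5); [|lra].
      field_simplify; [|lra]; lra. }
    assert (HvC : v2 * / (h1 z + z ^ 5) <= C).
    { unfold C; apply Rmult_le_compat.
      - lra.
      - apply Rlt_le, Rinv_0_lt_compat; lra.
      - assert (v2 * z ^ 4 <= 1).
        { apply Rmult_le_reg_r with z; [lra|].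
          replace (v2 * z ^ 4 * z) with (v2 * z ^ 5) by ring; nra. }
        apply Rmult_le_reg_r with (a ^ 4); [easy|]; rewrite Rinv_l by lra; nra.
      - apply Rinv_le_contravar; lra. }
    rewrite E.
    assert (Hsq : 0 <= (h1 z - h2 z) ^ 2) by apply pow2_ge_0.
    replace (- (2 * (h1 z - h2 z) * (- (v2 * / (h1 z + z ^ 5)) * (h1 z - h2 z))
       + 2 * C * (h1 z - h2 z) ^ 2))
      with (- (2 * ((C - v2 * / (h1 z + z ^ 5)) * (h1 z - h2 z) ^ 2))) by ring.
    assert (0 <= (C - v2 * / (h1 z + z ^ 5)) * (h1 z - h2 z) ^ 2)
      by (apply Rmult_le_pos; lra).
    nra.
  - evar_last.
    + apply @is_derive_opp, Derive.is_derive_mult.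
      * apply is_derive_pow, @is_derive_minus; eassumption.
      * apply is_derive_comp; [apply is_derive_Reals, derivable_pt_lim_exp|].
        apply is_derive_scal, is_derive_id.
    + unfold minus, plus, opp, scal, one; simpl; unfold mult; simpl; ring. }
rewrite Hb, Rminus_diag in H.
assert (He := exp_pos (2 * C * a)).
assert ((h1 a - h2 a) ^ 2 <= 0).
{ apply Rmult_le_reg_r with (exp (2 * C * a)); [easy|].
  rewrite pow_ne_zero in H by easy; lra. }
nra.
Qed.

Lemma solution_reflect (a b : R) (h : R -> R) :
  solution_on a b h -> solution_on (- b) (- a) (fun y => - h (- y)).
Proof.
intros [H0 H]; split; [now rewrite Ropp_0, H0, Ropp_0|].
intros z Hz; destruct (H (- z)) as [v Hv]; [lra|].
exists v; now apply slope_at_reflect.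
Qed.

Lemma solution_unique_pos (a b a' b' z : R) (h1 h2 : R -> R) :
  a < 0 -> a' < 0 -> solution_on a b h1 -> solution_on a' b' h2 ->
  0 <= z < b -> z < b' -> h1 z = h2 z.
Proof.
intros Ha Ha' [Z1 H1] [Z2 H2] Hz Hz'.
apply (solution_unique_forward h1 h2 0 z); [lra| | |lra].
- intros; apply H1; lra.
- intros; apply H2; lra.
Qed.

Lemma solution_unique (a b z : R) (h1 h2 : R -> R) :
  a < 0 < b -> solution_on a b h1 -> solution_on a b h2 ->
  a < z < b -> h1 z = h2 z.
Proof.
intros Hab H1 H2 Hz; destruct (Rle_lt_dec 0 z) as [Hpos|Hneg].
- apply (solution_unique_pos a b a b); try assumption; lra.
- apply solution_reflect in H1; apply solution_reflect in H2.
  assert (H := solution_unique_pos (- b) (- a) (- b) (- a) (- z) _ _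
    ltac:(lra) ltac:(lra) H1 H2 ltac:(lra) ltac:(lra)).
  cbv beta in H; rewrite Ropp_involutive in H; lra.
Qed.

(** The upper bound holds because [h^2 - z^2] has derivative [2 h v - 2 z = - 2 v z^5 <= 0]. These
    bounds confine the slope and hence the radii of the local series. *)
Lemma solution_bounds (a b z : R) (h : R -> R) :
  a < 0 -> solution_on a b h -> 0 < z < b -> 0 < h z <= z.
Proof.
intros Ha [H0 H] Hz.
assert (Hpos : 0 < h z).
{ rewrite <- H0; apply slope_at_strict_increasing; [lra|].
  intros; apply H; lra. }
split; [easy|].
assert (Hsq : h z ^ 2 - z ^ 2 <= h 0 ^ 2 - 0 ^ 2).
{ apply (nonincreasing_of_derive (fun y => h y ^ 2 - y ^ 2)); [lra|].
  intros y Hy; destruct (H y) as [v [V [D E]]]; [lra|].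
  exists (2 * h y * v - 2 * y); split.
  - assert (0 <= y ^ 5) by (apply pow_le; lra); nra.
  - evar_last.
    + apply @is_derive_minus; apply is_derive_pow; [exact D | apply is_derive_id].
    + unfold minus, plus, opp, one; simpl; ring. }
rewrite H0 in Hsq; nra.
Qed.

(** * The global solution *)

(** The relation [v (h + z^5) = z] holds by the choice of [h]; the slope equation is exactly the
    condition [h' = v]. *)
Lemma local_slope_height (p r : R) (a : nat -> R) :
  local_slope p r a ->
  forall z, Rabs (z - p) < r ->
    slope_at (fun y => y / PSeries a (y - p) - y ^ 5) z (PSeries a (z - p)).
Proof.
intros H z Hz; destruct (H _ Hz) as [Hrad [Hpos E]].
replace (p + (z - p)) with z in E by ring.
assert (Hd : is_derive (fun y => PSeries a (y - p)) z
          (PSeries (PS_derive a) (z - p))).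
{ evar_last.
  - apply (is_derive_comp (PSeries a) (fun y => y - p) z
      (PSeries (PS_derive a) (z - p)) 1).
    + now apply is_derive_PSeries.
    + auto_derive; [easy | ring].
  - unfold scal; simpl; unfold mult; simpl; ring. }
split; [easy|]; split.
- evar_last.
  + apply @is_derive_minus.
    * apply is_derive_div; [apply is_derive_id | exact Hd | lra].
    * apply is_derive_pow, is_derive_id.
  + unfold minus, plus, opp, one; simpl.
    rewrite E; field; lra.
- field; lra.
Qed.

Lemma solution_near_zero :
  exists r, 0 < r /\ exists a, local_slope 0 r a /\
    solution_on (- r) r (fun y => y / PSeries a (y - 0) - y ^ 5).
Proof.
destruct local_slope_singular as [r [a [Hr [Ha0 H]]]].
exists r; split; [easy|]; exists a; split; [easy|]; split.
- unfold Rdiv; ring.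
- intros z Hz; exists (PSeries a (z - 0)); apply (local_slope_height 0 r a H).
  rewrite Rminus_0_r; now apply Rabs_lt_between.
Qed.

Lemma PSeries_center (a : nat -> R) (p : R) : PSeries a (p - p) = a 0%nat.
Proof. rewrite Rminus_diag; apply PSeries_0. Qed.

(** The step [d] depends on [c] and [Z] alone, neither on [S] nor on the solution, so finitely many
    extensions reach [Z]. *)
Lemma solution_extend (c Z : R) :
  0 < c -> c <= Z -> exists d, 0 < d /\ forall S, c <= S <= Z ->
    (exists h, solution_on (- c) S h) -> exists h, solution_on (- c) (S + d) h.
Proof.
intros Hc HcZ.
assert (Z4 : 0 < Z ^ 4) by (apply pow_lt; lra).
assert (C4 : 0 < (c / 2) ^ 4) by (apply pow_lt; lra).
assert (Hm : 0 < / (1 + Z ^ 4) <= 1).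
{ split; [apply Rinv_0_lt_compat; lra|].
  rewrite <- Rinv_1; apply Rinv_le_contravar; lra. }
assert (HM : 0 < / (c / 2) ^ 4) by now apply Rinv_0_lt_compat.
(* From [0 < h p <= p] and [v = p / (h p + p^5)] follows [/ (1 + p^4) <= v < / p^4]. The extra [1 +]
   in the upper bound ensures that it exceeds the lower one. *)
destruct (local_slope_regular (c / 2) Z (/ (1 + Z ^ 4)) (1 + / (c / 2) ^ 4))
  as [r [Hr Hloc]]; [lra|lra|].
set (d := Rmin (r / 2) (c / 2)).
assert (Hd : 0 < d /\ d <= r / 2 /\ d <= c / 2).
{ split; [apply Rmin_glb_lt; lra|]; split; [apply Rmin_l | apply Rmin_r]. }
exists d; split; [easy|]; intros S HS [h Hh].
(* The new centre lies inside the known interval. Since [d <= r / 2], the series about [p] reaches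
   [S + d]; since [d <= c / 2], the centre stays above [c / 2]. *)
set (p := S - d).
destruct (proj2 Hh p) as [v Hv]; [unfold p; lra|].
assert (Hb := solution_bounds (- c) S p h ltac:(lra) Hh ltac:(unfold p; lra)).
destruct Hv as [V [D E]].
assert (Hp : c / 2 <= p <= Z) by (unfold p; lra).
assert (p4 : (c / 2) ^ 4 <= p ^ 4 <= Z ^ 4) by (split; apply pow_incr; lra).
destruct (Hloc p v) as [a [Ha0 Ha]]; [easy| |].
{ replace (p ^ 5) with (p * p ^ 4) in E by ring; split.
  - apply Rmult_le_reg_r with (1 + Z ^ 4); [lra|]; rewrite Rinv_l by lra.
    apply Rmult_le_reg_r with p; [lra|].
    assert (0 <= v * (p - h p)) by (apply Rmult_le_pos; lra).
    assert (0 <= v * p * (Z ^ 4 - p ^ 4))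
      by (apply Rmult_le_pos; [apply Rmult_le_pos|]; lra).
    lra.
  - assert (0 < v * h p) by (apply Rmult_lt_0_compat; lra).
    assert (v * p ^ 4 <= 1) by (apply Rmult_le_reg_r with p; lra).
    assert (v <= / (c / 2) ^ 4); [|lra].
    apply Rmult_le_reg_r with ((c / 2) ^ 4); [easy|]; rewrite Rinv_l by lra.
    nra. }
assert (Hk := local_slope_height p r a Ha).
set (k := fun y => y / PSeries a (y - p) - y ^ 5) in Hk.
assert (Hkp : h p = k p).
{ unfold k; rewrite PSeries_center, Ha0.
  apply Rmult_eq_reg_l with v; [|lra]; field_simplify; lra. }
assert (Hk' : forall z, p <= z < S + d -> exists w, slope_at k z w).
{ intros z Hz; eexists; apply Hk; unfold p in *; apply Rabs_lt_between; lra. }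
assert (Hagree : forall z, p <= z < S -> h z = k z).
{ intros z Hz; apply (solution_unique_forward h k p z); [lra| | |easy].
  - intros; apply (proj2 Hh); lra.
  - intros; apply Hk'; lra. }
(* The pieces agree on [[p, S)] and are joined at the interior point [S - d / 2], so near every
   point the glued function coincides with one single piece. *)
exists (fun z => if Rlt_dec z (S - d / 2) then h z else k z); split.
- destruct (Rlt_dec 0 (S - d / 2)); [apply Hh | lra].
- intros z Hz; destruct (Rlt_le_dec z (S - d / 2)) as [Hlt|Hge].
  + destruct (proj2 Hh z) as [w Hw]; [lra|]; exists w.
    apply slope_at_ext_loc with (2 := Hw).
    apply (locally_interval _ z m_infty (S - d / 2)); [easy|easy|].
    simpl; intros y _ Hy; destruct (Rlt_dec y (S - d / 2)); [easy|lra].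
  + destruct (Hk' z) as [w Hw]; [unfold p; lra|]; exists w.
    apply slope_at_ext_loc with (2 := Hw).
    apply (locally_interval _ z p p_infty); [simpl; unfold p; lra|easy|].
    simpl; intros y Hy _; destruct (Rlt_dec y (S - d / 2)); [|easy].
    symmetry; apply Hagree; lra.
Qed.

Lemma solution_restrict (a b b' : R) (h : R -> R) :
  b' <= b -> solution_on a b h -> solution_on a b' h.
Proof. intros Hb [H0 H]; split; [easy|]; intros z Hz; apply H; lra. Qed.

Lemma solution_up_to (c : R) :
  0 < c -> (exists h, solution_on (- c) c h) ->
  forall Z, c <= Z -> exists h, solution_on (- c) Z h.
Proof.
intros Hc H0 Z HZ.
destruct (solution_extend c Z Hc HZ) as [d [Hd Hext]].
(* The cap at [Z] keeps every right end within the range where the step [d] is valid. *)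
assert (Hn : forall n : nat,
          exists h, solution_on (- c) (Rmin Z (c + INR n * d)) h).
{ induction n as [|n IH].
  - simpl; rewrite Rmult_0_l, Rplus_0_r, Rmin_right by easy; easy.
  - destruct (Hext (Rmin Z (c + INR n * d))) as [h Hh]; [|easy|].
    + split; [|apply Rmin_l]; apply Rmin_glb; [easy|].
      generalize (pos_INR n); nra.
    + exists h; apply solution_restrict with (2 := Hh); rewrite S_INR.
      unfold Rmin; destruct (Rle_dec Z (c + INR n * d)),
        (Rle_dec Z (c + (INR n + 1) * d)); lra. }
destruct (INR_unbounded (Z / d)) as [n Hlarge].
destruct (Hn n) as [h Hh]; exists h.
rewrite Rmin_left in Hh; [easy|].
assert (Z = Z / d * d) by (field; lra); nra.
Qed.

Lemma lt_INR_up (z : R) : z < INR (Z.to_nat (up z)).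
Proof.
apply Rlt_le_trans with (IZR (up z)); [apply archimed|].
rewrite INR_IZR_INZ; apply IZR_le; lia.
Qed.

Lemma global_solution :
  exists h : R -> R, h 0 = 0 /\ forall z, exists v, slope_at h z v.
Proof.
destruct solution_near_zero as [c [Hc [a0 [_ H0]]]].
assert (Hex : forall n : nat, exists h, solution_on (- c) (c + INR n) h).
{ intros n; apply solution_up_to; [easy|eexists; exact H0|].
  generalize (pos_INR n); lra. }
destruct (functional_choice _ Hex) as [hs Hs].
set (N := fun z => Z.to_nat (up z)).
(* For [z >= 0] the index [N z] exceeds [z], so [z] lies in the domain of [hs (N z)]; negative
   arguments are handled by odd reflection. *)
set (h := fun z => if Rle_dec 0 z then hs (N z) z else - hs (N (- z)) (- z)).
assert (Hagree : forall n z, - c < z < INR n -> hs n z = h z).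
{ intros n z Hz; unfold h; destruct (Rle_dec 0 z) as [Hpos|Hneg].
  - apply (solution_unique_pos (- c) (c + INR n) (- c) (c + INR (N z)));
      [lra|lra|easy|easy|lra|].
    generalize (lt_INR_up z); fold (N z); lra.
  - assert (Hr := solution_reflect _ _ _ (Hs n)).
    (* The reflection of [hs n] is a solution on [(-(c + n), c)]. This interval contains [- z],
       where uniqueness identifies it with [hs (N (- z))]. *)
    assert (E : hs (N (- z)) (- z) = - hs n (- - z)).
    { apply (solution_unique_pos (- c) (c + INR (N (- z))) (- (c + INR n)) c
        (- z) (hs (N (- z))) (fun y => - hs n (- y)));
        [lra|generalize (pos_INR n); lra|easy
        |rewrite Ropp_involutive in Hr; exact Hr| |lra].
      generalize (lt_INR_up (- z)); fold (N (- z)); lra. }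
    rewrite E, !Ropp_involutive; reflexivity. }
assert (h00 : h 0 = 0).
{ unfold h; destruct (Rle_dec 0 0); [apply Hs | lra]. }
exists h; split; [easy|].
assert (Hpos : forall z, - c < z -> exists v, slope_at h z v).
{ intros z Hz; set (n := N z).
  assert (Hn : z < INR n) by apply lt_INR_up.
  destruct (proj2 (Hs n) z) as [v Hv]; [lra|]; exists v.
  apply slope_at_ext_loc with (2 := Hv).
  apply (locally_interval _ z (- c) (INR n)); [easy|easy|].
  intros y Hy1 Hy2; now apply Hagree. }
intros z; destruct (Rlt_le_dec (- c) z) as [Hz|Hz]; [now apply Hpos|].
destruct (Hpos (- z)) as [v Hv]; [lra|]; exists v.
apply slope_at_reflect in Hv.
apply slope_at_ext_loc with (2 := Hv).
apply (locally_interval _ z m_infty 0); [easy|simpl; lra|].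
simpl; intros y _ Hy; unfold h.
destruct (Rle_dec 0 (- y)); [|lra]; destruct (Rle_dec 0 y); [lra|easy].
Qed.

Lemma global_solution_odd (h : R -> R) (z : R) :
  h 0 = 0 -> (forall z, exists v, slope_at h z v) -> h (- z) = - h z.
Proof.
intros h0 hslope; set (b := Rabs z + 1).
assert (Hz : - b < z < b) by (apply Rabs_lt_between; unfold b; lra).
assert (Hh : solution_on (- b) b h) by (split; auto).
assert (Hr := solution_reflect _ _ _ Hh).
rewrite Ropp_involutive in Hr.
rewrite (solution_unique (- b) b z h _ ltac:(lra) Hh Hr Hz).
ring.
Qed.


(** * Analyticity, limit and normalisation *)

(** The condition of [real_analytic] at a single centre, so that negative, zero and positive centres
    can be treated by different means. *)
Definition analytic_at (f : R -> R) (x0 : R) : Prop :=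
  exists (a : nat -> R) (r : R),
    0 < r /\ forall x : R, Rabs (x - x0) < r -> is_pseries a (x - x0) (f x).

Lemma analytic_at_ext_loc (f g : R -> R) (x0 r : R) :
  0 < r -> (forall x, Rabs (x - x0) < r -> f x = g x) ->
  analytic_at f x0 -> analytic_at g x0.
Proof.
intros Hr Hfg [a [s [Hs H]]]; exists a, (Rmin r s); split.
- now apply Rmin_glb_lt.
- intros x Hx; rewrite <- Hfg.
  + apply H, Rlt_le_trans with (1 := Hx), Rmin_r.
  + apply Rlt_le_trans with (1 := Hx), Rmin_l.
Qed.

Lemma analytic_at_dilation (f : R -> R) (k c x0 : R) :
  c <> 0 -> analytic_at f (c * x0) -> analytic_at (fun x => k * f (c * x)) x0.
Proof.
intros Hc [a [r [Hr H]]].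
assert (Hc' := Rabs_pos_lt c Hc).
exists (fun n => k * (a n * c ^ n)), (r / Rabs c); split.
- now apply Rdiv_lt_0_compat.
- intros x Hx; apply is_pseries_R.
  apply is_series_ext with
    (fun n => scal k (a n * (c * x - c * x0) ^ n)).
  + intros n; rewrite <- Rmult_minus_distr_l, Rpow_mult_distr.
    unfold scal; simpl; unfold mult; simpl; ring.
  + apply (is_series_scal_l k (fun n => a n * (c * x - c * x0) ^ n) (f (c * x))).
    apply is_pseries_R, H.
    rewrite <- Rmult_minus_distr_l, Rabs_mult.
    apply Rmult_lt_reg_r with (/ Rabs c); [now apply Rinv_0_lt_compat|].
    replace (Rabs c * Rabs (x - x0) * / Rabs c) with (Rabs (x - x0))
      by (field; lra).
    exact Hx.
Qed.

(** Termwise integration of [a], with constant term [f p], differs from [f] by a function with zero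
    derivative that vanishes at [p]. Thus the height is analytic because its slope is a series,
    without expanding the quotient [z / v]. *)
Lemma analytic_at_of_derive (f : R -> R) (a : nat -> R) (p r : R) :
  0 < r ->
  (forall z, Rabs (z - p) < r ->
     Rbar_lt (Rabs (z - p)) (CV_radius a) /\ is_derive f z (PSeries a (z - p))) ->
  analytic_at f p.
Proof.
intros Hr H.
set (b := fun n => match n with 0%nat => f p | S m => a m / INR (S m) end).
assert (Hb : forall n, PS_derive b n = a n).
{ intros n; unfold PS_derive, b; field; apply not_0_INR; lia. }
assert (Hcv : CV_radius b = CV_radius a).
{ rewrite <- CV_radius_derive; now apply CV_radius_ext. }
exists b, r; split; [easy|]; intros x Hx.
assert (Hder : forall z, Rabs (z - p) < r ->
          is_derive (fun y => f y - PSeries b (y - p)) z 0).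
{ intros z Hz; destruct (H z Hz) as [Hrad Hd].
  evar_last.
  - apply @is_derive_minus; [exact Hd|].
    apply (is_derive_comp (PSeries b) (fun y => y - p) z
      (PSeries (PS_derive b) (z - p)) 1).
    + apply is_derive_PSeries; now rewrite Hcv.
    + auto_derive; [easy | ring].
  - rewrite (PSeries_ext _ _ _ Hb).
    unfold minus, plus, opp, scal; simpl; unfold mult; simpl; ring. }
assert (Hin : forall z, Rmin p x <= z <= Rmax p x -> Rabs (z - p) < r).
{ intros z Hz; apply Rabs_lt_between in Hx; apply Rabs_lt_between.
  revert Hz; unfold Rmin, Rmax; destruct (Rle_dec p x); lra. }
destruct (MVT_gen (fun y => f y - PSeries b (y - p)) p x (fun _ => 0))
  as [y [_ Heq]].
- intros z Hz; apply Hder, Hin; lra.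
- intros z Hz; apply derivable_continuous_pt; exists 0.
  apply is_derive_Reals, Hder, Hin, Hz.
- rewrite PSeries_center, Rmult_0_l in Heq; simpl in Heq.
  replace (f x) with (PSeries b (x - p)) by lra.
  apply PSeries_correct, CV_radius_inside; rewrite Hcv; now apply H.
Qed.

Lemma local_slope_analytic (p r : R) (a : nat -> R) :
  0 < r -> local_slope p r a ->
  analytic_at (fun y => y / PSeries a (y - p) - y ^ 5) p.
Proof.
intros Hr H; apply analytic_at_of_derive with a r; [easy|].
intros z Hz; split; [now apply H|].
now apply (local_slope_height p r a H z Hz).
Qed.

(** * Smoothness and even-order derivatives of odd functions *)

Definition smooth (f : R -> R) : Prop := forall k x, ex_derive_n f k x.

Lemma real_analytic_smooth (f : R -> R) : real_analytic f -> smooth f.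
Proof.
intros Hf k x0; destruct (Hf x0) as [a [r [Hr H]]].
assert (Hrad : Rbar_lt 0 (CV_radius a)).
{ apply Rbar_lt_le_trans with (Rabs (r / 2)).
  - simpl; rewrite Rabs_pos_eq; lra.
  (* Beyond the radius of convergence the terms cannot tend to zero, yet the series converges at
     distance [r / 2] from the centre. *)
  - apply Rbar_not_lt_le; intros Hlt; apply CV_disk_outside in Hlt.
    apply Hlt, (ex_series_lim_0 (fun n => a n * (r / 2) ^ n)).
    exists (f (x0 + r / 2)); apply is_pseries_R.
    replace (r / 2) with (x0 + r / 2 - x0) at 1 by ring.
    apply H; rewrite Rabs_pos_eq; lra. }
apply ex_derive_n_ext_loc with (fun y => PSeries a (y + - x0)).
- exists (mkposreal r Hr); intros y Hy.
  apply is_pseries_unique, (H y Hy).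
- apply ex_derive_n_comp_trans, ex_derive_n_PSeries.
  now rewrite Rplus_opp_r, Rabs_R0.
Qed.

Lemma Derive_n_Derive (f : R -> R) (k : nat) (x : R) :
  Derive_n (Derive f) k x = Derive_n f (S k) x.
Proof.
replace (S k) with (k + 1)%nat by lia; now rewrite <- Derive_n_comp.
Qed.

Lemma smooth_Derive (f : R -> R) : smooth f -> smooth (Derive f).
Proof.
intros H [|k] x; [easy|].
apply ex_derive_ext with (2 := H (S (S k)) x).
intros t; now rewrite Derive_n_Derive.
Qed.

(** The derivative of a product is a sum of two products, and the rule for sums asks for all lower
    orders as well; hence strong induction, for all pairs of functions at once. *)
Lemma smooth_mult (f g : R -> R) :
  smooth f -> smooth g -> smooth (fun x => f x * g x).
Proof.
intros Hf Hg k; revert f g Hf Hg.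
induction k as [k IH] using (well_founded_induction PeanoNat.Nat.lt_wf_0).
intros f g Hf Hg x.
destruct k as [|[|k]]; [easy| |].
- apply ex_derive_mult; [apply (Hf 1%nat) | apply (Hg 1%nat)].
- apply ex_derive_ext with (Derive_n (Derive (fun y => f y * g y)) k).
  { intros t; now rewrite Derive_n_Derive. }
  apply (ex_derive_n_ext (fun y => Derive f y * g y + f y * Derive g y) _ (S k)).
  { intros t; symmetry; apply Derive_mult; [apply (Hf 1%nat) | apply (Hg 1%nat)]. }
  apply ex_derive_n_plus; apply filter_forall; intros y j Hj;
    apply IH; auto using smooth_Derive; lia.
Qed.

(** The derivative of order [2 * n] of [f (- x)] at [0] is computed twice: with a minus sign by
    oddness, and with the sign [(-1)^(2n) = 1] by the chain rule. *)
Lemma odd_Derive_n_even (f : R -> R) (n : nat) :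
  smooth f -> (forall x, f (- x) = - f x) -> Derive_n f (2 * n) 0 = 0.
Proof.
intros Hf Hodd.
assert (H := Derive_n_comp_opp f (2 * n) 0).
rewrite (Derive_n_ext _ (fun x => - f x) _ _ Hodd), Derive_n_opp in H.
rewrite pow_1_even, Ropp_0 in H.
enough (- Derive_n f (2 * n) 0 = 1 * Derive_n f (2 * n) 0) by lra.
apply H, filter_forall; intros; apply Hf.
Qed.

(** * Analyticity and limit of the global solution *)

Lemma global_solution_pos (h : R -> R) (z : R) :
  h 0 = 0 -> (forall z, exists v, slope_at h z v) -> 0 < z -> 0 < h z.
Proof.
intros h0 hslope Hz; rewrite <- h0; now apply slope_at_strict_increasing.
Qed.

(** The local series at [p] with slope [v] yields a solution [k] with [k p = h p]. Forward
    uniqueness identifies it with [h] to the right of [p], backward uniqueness to the left. *)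
Lemma global_solution_analytic_pos (h : R -> R) (p : R) :
  h 0 = 0 -> (forall z, exists v, slope_at h z v) -> 0 < p -> analytic_at h p.
Proof.
intros h0 hslope Hp; destruct (hslope p) as [v [V [D E]]].
destruct (local_slope_regular p p v v Hp) as [r [Hr Hloc]]; [lra|].
destruct (Hloc p v) as [a [Ha0 Ha]]; [lra|lra|].
assert (Hk := local_slope_height p r a Ha).
assert (Hka := local_slope_analytic p r a Hr Ha).
set (k := fun y => y / PSeries a (y - p) - y ^ 5) in *.
assert (Hkp : h p = k p).
{ unfold k; rewrite PSeries_center, Ha0.
  apply Rmult_eq_reg_l with v; [|lra]; field_simplify; lra. }
(* Backward uniqueness requires positive heights; for [k] this is known near [p] only, by
   continuity. *)
assert (Hcont : locally p (fun y => 0 < k y)).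
{ destruct (Hk p) as [_ [Dk _]]; [rewrite Rminus_diag, Rabs_R0; easy|].
  assert (Hck := ex_derive_continuous k p (ex_intro _ _ Dk)).
  apply (Hck (fun y => 0 < y)), open_gt.
  rewrite <- Hkp; now apply global_solution_pos. }
destruct Hcont as [s Hs].
set (t := Rmin (Rmin r s) p).
assert (Ht : 0 < t /\ t <= r /\ t <= s /\ t <= p).
{ assert (Hs0 := cond_pos s); assert (H1 := Rmin_l (Rmin r s) p).
  assert (H2 := Rmin_l r s); assert (H3 := Rmin_r r s).
  assert (H4 := Rmin_r (Rmin r s) p); fold t in H1, H4.
  split; [repeat apply Rmin_glb_lt; easy | lra]. }
apply analytic_at_ext_loc with k t; [easy| |easy].
intros z Hz; apply Rabs_lt_between in Hz; symmetry.
assert (Hk' : forall y, p - t < y < p + t -> exists w, slope_at k y w).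
{ intros y Hy; eexists; apply Hk, Rabs_lt_between; lra. }
destruct (Rle_lt_dec p z) as [Hpz|Hzp].
- apply (solution_unique_forward h k p z); [lra|auto| |easy].
  intros; apply Hk'; lra.
- apply (solution_unique_backward h k z p); [lra|auto| | | |easy].
  + intros; apply Hk'; lra.
  + apply global_solution_pos; [easy|easy|lra].
  + apply Hs, Rabs_lt_between; change (- s < z - p < s); lra.
Qed.

(** Oddness transports the positive case to negative centres; at [0] uniqueness identifies [h] with
    the solution built from the singular series. *)
Lemma global_solution_analytic (h : R -> R) :
  h 0 = 0 -> (forall z, exists v, slope_at h z v) -> real_analytic h.
Proof.
intros h0 hslope p; change (analytic_at h p).
destruct (Rtotal_order p 0) as [Hneg|[->|Hpos]].
- apply analytic_at_ext_loc with (fun z => -1 * h (-1 * z)) 1; [lra| |].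
  + intros z _; replace (-1 * z) with (- z) by ring; 
    rewrite global_solution_odd by easy; ring.
  + apply analytic_at_dilation; [lra|].
    apply global_solution_analytic_pos; [easy|easy|lra].
- destruct solution_near_zero as [r [Hr [a [Ha Hsol]]]].
  apply analytic_at_ext_loc with (fun y => y / PSeries a (y - 0) - y ^ 5) r;
    [easy| |now apply local_slope_analytic with r].
  intros z Hz; rewrite Rminus_0_r in Hz; apply Rabs_lt_between in Hz.
  apply (solution_unique (- r) r z (fun y => y / PSeries a (y - 0) - y ^ 5) h);
    [lra|easy|split; auto|easy].
- now apply global_solution_analytic_pos.
Qed.

Lemma global_solution_limit (h : R -> R) :
  h 0 = 0 -> (forall z, exists v, slope_at h z v) ->
  exists L, 0 < L /\ forall eps, 0 < eps ->
    exists M, forall z, M < z -> Rabs (h z - L) < eps.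
Proof.
intros h0 hslope.
assert (Hinc : forall x y, x <= y -> h x <= h y).
{ intros; now apply slope_at_increasing. }
assert (Hbound : forall z, h z <= h 1 + 1).
{ intros z; destruct (Rle_lt_dec z 1) as [Hz|Hz].
  { assert (H := Hinc z 1 Hz); lra. }
  assert (H : h z + / z <= h 1 + / 1).
  (* For [y >= 1] the slope satisfies [v <= / y^4 <= / y^2], so it is outweighed by the derivative
     of [/ y]. *)
  { apply (nonincreasing_of_derive (fun y => h y + / y)); [lra|].
    intros y Hy; destruct (hslope y) as [v [V [D E]]].
    exists (v + - / y ^ 2); split.
    - assert (Hhy := global_solution_pos h y h0 hslope ltac:(lra)).
      assert (Hvh : 0 < v * h y) by now apply Rmult_lt_0_compat.
      assert (Hy2 : 1 <= y ^ 2) by (simpl; nra).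
      assert (Hv4 : v * y ^ 2 * y ^ 2 <= 1).
      { apply Rmult_le_reg_r with y; [lra|].
        replace (v * y ^ 2 * y ^ 2 * y) with (v * y ^ 5) by ring; lra. }
      assert (v * y ^ 2 <= 1).
      { apply Rle_trans with (2 := Hv4).
        rewrite <- (Rmult_1_r (v * y ^ 2)) at 1.
        apply Rmult_le_compat_l; [nra | easy]. }
      assert (v <= / y ^ 2); [|lra].
      apply Rmult_le_reg_r with (y ^ 2); [lra|]; rewrite Rinv_l by lra; easy.
    - apply @is_derive_plus; [exact D|].
      auto_derive; [lra|]; field; lra. }
  assert (0 < / z) by (apply Rinv_0_lt_compat; lra).
  rewrite Rinv_1 in H; lra. }
destruct (completeness (fun y => exists z, y = h z)) as [L [Hub Hlub]].
- exists (h 1 + 1); intros y [z ->]; apply Hbound.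
- exists (h 0); now exists 0.
- assert (Hle : forall z, h z <= L) by (intros z; apply Hub; now exists z).
  exists L; split.
  + apply Rlt_le_trans with (h 1); [apply global_solution_pos; [easy|easy|lra]
    | apply Hle].
  + intros eps Heps.
    destruct (not_all_ex_not _ (fun z => h z <= L - eps))
      as [M HM].
    * intros Hall; assert (L <= L - eps); [|lra].
      apply Hlub; intros y [z ->]; apply Hall.
    * exists M; intros z Hz; assert (H1 := Hinc M z ltac:(lra)).
      assert (H2 := Hle z); apply Rabs_lt_between; lra.
Qed.

Lemma fifth_root (L : R) : 0 < L -> exists c, 0 < c /\ c ^ 5 = L.
Proof.
intros HL; exists (Rpower L (/ 5)); split; [apply exp_pos|].
rewrite <- Rpower_pow by apply exp_pos.
rewrite Rpower_mult; replace (/ 5 * INR 5) with 1 by (simpl; field).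
now apply Rpower_1.
Qed.

Theorem proposition6p1 :
  exists g : R -> R,
    solves_profile_ode g /\
    is_lim g m_infty 1 /\
    is_lim g p_infty (-1) /\
    (g 0 = 0 /\ Derive_n g 2 0 = 0 /\ Derive_n g 4 0 = 0) /\
    (forall z : R, z < 0 -> 0 < g z) /\
    strict_decreasing g /\
    real_analytic g.
Proof.
destruct global_solution as [h [h0 hslope]].
destruct (global_solution_limit h h0 hslope) as [L [HL Hlim]].
destruct (fifth_root L HL) as [c [Hc HcL]].
assert (HLi : 0 < / L) by now apply Rinv_0_lt_compat.
(* The factor [- / L] makes the limit at plus infinity [-1]; the dilation with [c^5 = L] then
   restores the coefficient [1] of [z^5 g']. *)
set (g := fun z => - / L * h (c * z)).
assert (Hodd : forall z, g (- z) = - g z).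
{ intros z; unfold g; rewrite <- Ropp_mult_distr_r, global_solution_odd by easy.
  ring. }
assert (Hdec : strict_decreasing g).
{ intros x y Hxy; unfold g.
  assert (h (c * x) < h (c * y)); [|nra].
  apply slope_at_strict_increasing; [nra | auto]. }
assert (g0 : g 0 = 0) by (unfold g; rewrite Rmult_0_r, h0; ring).
assert (Hana : real_analytic g).
{ intros z; apply analytic_at_dilation; [lra|].
  now apply global_solution_analytic. }
assert (Hsm := real_analytic_smooth g Hana).
assert (Hlim' : forall eps, 0 < eps ->
          exists M, forall z, M < z -> Rabs (g z + 1) < eps).
{ intros eps Heps; destruct (Hlim (eps * L)) as [M HM].
  { now apply Rmult_lt_0_compat. }
  exists (M / c); intros z Hz.
  unfold g; replace (- / L * h (c * z) + 1) with (- (/ L * (h (c * z) - L)))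
    by (field; lra).
  rewrite Rabs_Ropp, Rabs_mult, Rabs_pos_eq by lra.
  apply Rmult_lt_reg_l with L; [easy|]; rewrite <- Rmult_assoc, Rinv_r by lra.
  rewrite Rmult_1_l, (Rmult_comm L); apply HM.
  apply Rmult_lt_reg_r with (/ c); [now apply Rinv_0_lt_compat|].
  replace (c * z * / c) with z by (field; lra); exact Hz. }
exists g; split; [split|split; [|split; [|split; [|split; [|split]]]]].
- intros; apply Hsm.
- intros z.
  (* The equation integrated four times: the two sides differ by a linear term, which the fourth
     derivative annihilates. *)
  assert (Hfirst : forall y, g y * Derive g y
            = y ^ 5 * Derive g y + c ^ 2 * / L ^ 2 * y).
  { intros y; destruct (hslope (c * y)) as [v [V [D E]]].
    assert (Dg : is_derive g y (- / L * (c * v))).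
    { apply is_derive_scal, is_derive_comp with (1 := D).
      auto_derive; [easy | ring]. }
    rewrite (is_derive_unique _ _ _ Dg); unfold g.
    replace (h (c * y)) with ((h (c * y) + (c * y) ^ 5) - L * y ^ 5)
      by (rewrite Rpow_mult_distr, HcL; ring).
    apply Rminus_diag_uniq.
    transitivity (c / L ^ 2 * (v * (h (c * y) + (c * y) ^ 5) - c * y));
      [field; lra | rewrite E; ring]. }
  rewrite (Derive_n_ext _ _ 4 z Hfirst), Derive_n_plus.
  + rewrite Derive_n_scal_l.
    rewrite (Derive_n_ext (fun y => y) (fun y => y ^ 1)) by (intros; ring).
    rewrite Derive_n_pow_bigi by lia; ring.
  + apply filter_forall; intros y k _; apply smooth_mult.
    * intros j x; apply ex_derive_n_pow.
    * now apply smooth_Derive.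
  + apply filter_forall; intros y k _; apply ex_derive_n_scal_l.
    apply (ex_derive_n_ext (fun x => x ^ 1)); [intros; ring|].
    apply ex_derive_n_pow.
- apply is_lim_spec; intros eps; destruct (Hlim' eps (cond_pos eps)) as [M HM].
  exists (- M); intros z Hz.
  replace (g z - 1) with (- (g (- z) + 1)) by (rewrite Hodd; ring).
  rewrite Rabs_Ropp; apply HM; lra.
- apply is_lim_spec; intros eps; destruct (Hlim' eps (cond_pos eps)) as [M HM].
  exists M; intros z Hz.
  replace (g z - -1) with (g z + 1) by ring; now apply HM.
- split; [easy|]; split.
  + now apply (odd_Derive_n_even g 1).
  + now apply (odd_Derive_n_even g 2).
- intros z Hz; rewrite <- g0; now apply Hdec.
- easy.
- easy.
Qed.
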